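(* Consider a relative equilibrium of a spherical body and an axially symmetric body ($N=2$, $m=1$), with relative position $\mathbf q=(x,y,z)$, symmetry axis $\mathbf a=(u,v,w)$ and rotation vector $\omega\,\mathbf e_3$. If the three vectors $\mathbf q,\mathbf a,\mathbf e_3$ are linearly independent, then necessarily $$z=w=0,$$ so that this type of relative equilibrium is restricted to be of Lagrangian type, with $\mathbf a$ lying in the orbital plane, and moreover the coefficients must satisfy $$a_{22}=\tfrac12\,m_{12}\,\omega^2,\qquad b_{21}=\mu_1=0.$$
   Context: The bodies have masses $m_1,m_2$, and $m_{12}=m_1m_2/(m_1+m_2)$. $\mathbf q\in\mathbb R^3$ is the relative position vector of the two bodies, and $\mathbf a\in\mathbb R^3$ is the unit symmetry axis, in the spatial frame, of the axially symmetric body, whose principal moments of inertia are $\Theta_{11},\Theta_{11},\Theta_{13}$; $\mathbf e_3=(0,0,1)^T$. The constant $k_1$ is either $\omega(\Theta_{13}-\Theta_{11})$ or $0$; it is the constant for which the spatial angular momentum of the axially symmetric body in the relative equilibrium is $\Theta_{11}\,\omega\,\mathbf e_3+k_1w\,\mathbf a$. By $O(3)$-invariance the gravitational potential is a function $\tilde V$ of $q_{22}=\mathbf q\cdot\mathbf q$ and $\nu_{21}=\mathbf q\cdot\mathbf a$; here $a_{22}=\partial\tilde V/\partial q_{22}$ and $b_{21}=\partial\tilde V/\partial\nu_{21}$, evaluated at the configuration. The configuration $(\mathbf q,\mathbf a)$ is a relative equilibrium (rigid rotation of all vectors about $\mathbf e_3$ with angular velocity $\omega$) when, for some constant $\mu_1\in\mathbb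 R$, $$2a_{22}\,\mathbf q+b_{21}\,\mathbf a=\omega^2m_{12}\,(x,y,0)^T,\qquad b_{21}\,\mathbf q+\mu_1\,\mathbf a=\omega\,k_1\,w\,\mathbf e_3.$$ A relative equilibrium is of Lagrangian type if the centers of mass of all bodies move in the same plane.
   Formalization: The conclusion w = 0, and with it that a lies in the orbital plane, is asserted only when k_1 ≠ 0, since it fails for k_1 = 0 (e.g. q=(1,0,0), a=(0,3/5,4/5), b_21=0); the rotation is assumed nontrivial, ω ≠ 0, as z and w are otherwise undetermined. *)

(* Defs.v *)
From HB Require Import structures.
From mathcomp Require Import all_boot all_order all_algebra.
From mathcomp Require Import all_classical all_reals all_analysis.

Set Implicit Arguments.
Unset Strict Implicit.
Unset Printing Implicit Defensive.

Import Order.TTheory GRing.Theory Num.Theory.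
Import numFieldNormedType.Exports.

Local Open Scope ring_scope.

Section Defs.
Variable R : realType.
Implicit Types (q a n : 'cV[R]_3) (V : R -> R -> R).

Definition vec3 (x y z : R) : 'cV[R]_3 := \col_i [:: x; y; z]`_i.

Definition e3 : 'cV[R]_3 := vec3 0 0 1.

Definition dot (p r : 'cV[R]_3) : R := \sum_i p i 0 * r i 0.

Definition reduced_mass (m1 m2 : R) : R := m1 * m2 / (m1 + m2).

(* [V s t] is the potential as a function of s = q.q and t = q.a; the
   partial derivatives are taken at the configuration (q, a).
   Only the germ of V there matters, so V may be arbitrary where the physical
   potential is undefined. *)
Definition is_dV_dq22 V q a (a22 : R) : Prop :=
  is_derive (dot q q) 1 (fun s => V s (dot q a)) a22.

Definition is_dV_dnu21 V q a (b21 : R) : Prop :=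
  is_derive (dot q a) 1 (fun t => V (dot q q) t) b21.

(* mu1 is the multiplier of the constraint |a| = 1. *)
Definition rel_equilibrium (m12 omega k1 a22 b21 mu1 x y z u v w : R) : Prop :=
  let q := vec3 x y z in
  let a := vec3 u v w in
  (2 * a22) *: q + b21 *: a = (omega ^+ 2 * m12) *: vec3 x y 0 /\
  b21 *: q + mu1 *: a = (omega * k1 * w) *: e3.

Definition rot_e3 (theta : R) : 'M[R]_3 :=
  \matrix_(i, j)
    (nth [::] [:: [:: cos theta; - sin theta; 0];
                  [:: sin theta;   cos theta; 0];
                  [:: 0;           0;         1]] i)`_j.

(* Positions of the two centers of mass in the barycentric frame, for the
   relative position q rotating rigidly about e3. *)
Definition two_body_motion (m1 m2 omega : R) q (i : 'I_2) (t : R) : 'cV[R]_3 :=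
  rot_e3 (omega * t) *m
    ([:: - (m2 / (m1 + m2)); m1 / (m1 + m2)]`_i *: q).

(* The bodies have trajectories [c i]; the plane {p | n.p = d} contains
   all of them. *)
Definition orbital_plane N (c : 'I_N -> R -> 'cV[R]_3) n (d : R) : Prop :=
  n != 0 /\ forall i t, dot n (c i t) = d.

Definition lagrangian_type N (c : 'I_N -> R -> 'cV[R]_3) : Prop :=
  exists n d, orbital_plane c n d.

Definition direction_in_orbital_plane N (c : 'I_N -> R -> 'cV[R]_3)
    (b : R -> 'cV[R]_3) : Prop :=
  forall n d, orbital_plane c n d -> forall t, dot n (b t) = 0.

End Defs.

Arguments e3 {R}.

(* Main.v *)
Require Import Defs.
From HB Require Import structures.
From mathcomp Require Import all_boot all_order all_algebra.
From mathcomp Require Import all_classical all_reals all_analysis.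
From mathcomp Require Import ring.
Import Order.TTheory GRing.Theory Num.Theory.
Import numFieldNormedType.Exports.
Local Open Scope ring_scope.

(** Each of the two equilibrium equations is a linear relation between [q],
    [a] and [e3], once the horizontal part of [q] is written as
    [vec3 x y 0 = q - z *: e3].  Linear independence therefore annihilates
    every coefficient ([free3_eq0]): the equation for [a] gives
    [b21 = mu1 = omega * k1 * w = 0], and the equation for [q] gives
    [2 * a22 = omega ^+ 2 * m12] and [omega ^+ 2 * m12 * z = 0], hence [z = 0]
    because the reduced mass is positive.  When [k1 <> 0] it follows that
    [w = 0].

    With [z = 0] both centers of mass stay in the plane orthogonal to [e3],
    so the motion is of Lagrangian type.  That plane is the only one: [q] is a
    nonzero horizontal vector, and its positions at the angles 0, pi/2 and pi
    already force the normal of an orbital plane to be vertical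
    ([horizontal_orbit_normal]).  Hence a horizontal axis, which stays
    horizontal under the rotation, lies in every orbital plane. *)

Lemma vec3_coord {R : realType} (p : 'cV[R]_3) :
  p = vec3 (p 0 0) (p 1 0) (p 2 0).
Proof.
apply/colP => i; rewrite mxE.
by case: i => [[|[|[|//]]] Hi] /=; congr (p _ _); apply: val_inj.
Qed.

Lemma vec3D {R : realType} (x y z x' y' z' : R) :
  vec3 x y z + vec3 x' y' z' = vec3 (x + x') (y + y') (z + z').
Proof. by apply/colP => i; rewrite !mxE; case: i => [[|[|[|//]]] Hi]. Qed.

Lemma vec3Z {R : realType} (c x y z : R) :
  c *: vec3 x y z = vec3 (c * x) (c * y) (c * z).
Proof. by apply/colP => i; rewrite !mxE; case: i => [[|[|[|//]]] Hi]. Qed.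

Lemma dot_vec3 {R : realType} (x y z x' y' z' : R) :
  dot (vec3 x y z) (vec3 x' y' z') = x * x' + y * y' + z * z'.
Proof. by rewrite /dot !big_ord_recl big_ord0 !mxE /= addr0 addrA. Qed.

Lemma rot_e3_vec3 {R : realType} (th x y z : R) :
  rot_e3 th *m vec3 x y z =
  vec3 (cos th * x - sin th * y) (sin th * x + cos th * y) z.
Proof.
apply/colP => i; rewrite !mxE !big_ord_recl big_ord0 !mxE /=.
by case: i => [[|[|[|//]]] Hi] /=; ring.
Qed.

Lemma free3_eq0 {R : realType} {p r s : 'cV[R]_3} {al be ga : R} :
  free [:: p; r; s] -> al *: p + be *: r + ga *: s = 0 ->
  [/\ al = 0, be = 0 & ga = 0].
Proof.
move=> /(@freeP _ _ _ (in_tuple [:: p; r; s])) fr E.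
have /= K := fr (fun i => [:: al; be; ga]`_i).
have {}K : forall i : 'I_3, [:: al; be; ga]`_i = 0.
  by apply: K; rewrite !big_ord_recl big_ord0 /= addr0 addrA.
by split; [exact: (K 0) | exact: (K 1) | exact: (K 2)].
Qed.

Lemma reduced_mass_gt0 {R : realType} (m1 m2 : R) :
  0 < m1 -> 0 < m2 -> 0 < reduced_mass m1 m2.
Proof. by move=> h1 h2; rewrite /reduced_mass divr_gt0 ?mulr_gt0 ?addr_gt0. Qed.

(** The positions at the angles 0 and pi are opposite, so the plane passes
    through the barycenter; the positions at 0 and pi/2 are then two orthogonal
    horizontal vectors, both orthogonal to [n].  The trajectory of the second body suffices. *)
Lemma horizontal_orbit_normal {R : realType} {m1 m2 omega x y d : R}
    {n : 'cV[R]_3} :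
  0 < m1 -> 0 < m2 -> omega != 0 -> vec3 x y 0 != 0 :> 'cV[R]_3 ->
  orbital_plane (two_body_motion m1 m2 omega (vec3 x y 0)) n d ->
  n = vec3 0 0 (n 2 0).
Proof.
move=> m1_gt0 m2_gt0 om0 q0 [_ plane].
rewrite [n in LHS]vec3_coord.
set n1 := n 0 0; set n2 := n 1 0; set n3 := n 2 0.
set c := m1 / (m1 + m2).
have c0 : c != 0 by rewrite gt_eqF // divr_gt0 ?addr_gt0.
have orbit th : c * (n1 * (cos th * x - sin th * y) +
                     n2 * (sin th * x + cos th * y)) = d.
  have := plane 1 (omega^-1 * th).
  rewrite /two_body_motion mulVKf //= vec3Z rot_e3_vec3.
  rewrite [n in dot n _]vec3_coord dot_vec3 => <-.
  by rewrite -/n1 -/n2 -/n3 -/c; ring.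
have d0 : d = 0.
  have /eqP : d + d = 0.
    rewrite -{1}(orbit 0) -(orbit pi) cos0 sin0 cospi sinpi; ring.
  by rewrite -mulr2n mulrn_eq0 => /eqP.
have E1 : n1 * x + n2 * y = 0.
  apply: (mulfI c0); rewrite mulr0 -d0 -(orbit 0) cos0 sin0; ring.
have E2 : n2 * x - n1 * y = 0.
  apply: (mulfI c0).
  rewrite mulr0 -d0 -(orbit (pi / 2)) cos_pihalf sin_pihalf; ring.
have r0 : x ^+ 2 + y ^+ 2 != 0.
  apply: contraNneq q0 => /eqP.
  rewrite paddr_eq0 ?sqr_ge0 // !sqrf_eq0 => /andP[/eqP -> /eqP ->].
  by apply/eqP/colP => i; rewrite !mxE; case: i => [[|[|[|//]]] Hi].
have -> : n1 = 0.
  apply: (mulIf r0); rewrite mul0r.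
  have -> : n1 * (x ^+ 2 + y ^+ 2) =
    x * (n1 * x + n2 * y) - y * (n2 * x - n1 * y) by ring.
  by rewrite E1 E2 !mulr0 subr0.
have -> // : n2 = 0.
apply: (mulIf r0); rewrite mul0r.
have -> : n2 * (x ^+ 2 + y ^+ 2) =
  y * (n1 * x + n2 * y) + x * (n2 * x - n1 * y) by ring.
by rewrite E1 E2 !mulr0 addr0.
Qed.

Lemma horizontal_lagrangian {R : realType} (m1 m2 omega x y : R) :
  lagrangian_type (two_body_motion m1 m2 omega (vec3 x y 0)).
Proof.
exists e3, 0; split.
  apply/eqP => /colP/(_ 2); rewrite !mxE /= => /eqP.
  by rewrite oner_eq0.
move=> i t.
by rewrite /two_body_motion vec3Z rot_e3_vec3 dot_vec3 mulr0 !mul0r mulr0 !addr0.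
Qed.

Theorem mainTheorem7 (R : realType) (V : R -> R -> R)
    (m1 m2 Theta11 Theta13 omega k1 : R)
    (x y z u v w : R) (a22 b21 mu1 : R) :
  let q := vec3 x y z in
  let a := vec3 u v w in
  let m12 := reduced_mass m1 m2 in
  let motion := two_body_motion m1 m2 omega q in
  0 < m1 -> 0 < m2 -> omega <> 0 ->
  k1 = omega * (Theta13 - Theta11) \/ k1 = 0 ->
  dot a a = 1 ->
  is_dV_dq22 V q a a22 ->
  is_dV_dnu21 V q a b21 ->
  rel_equilibrium m12 omega k1 a22 b21 mu1 x y z u v w ->
  free [:: q; a; e3] ->
  z = 0 /\
  (k1 <> 0 ->
     w = 0 /\
     direction_in_orbital_plane motion (fun t => rot_e3 (omega * t) *m a)) /\
  lagrangian_type motion /\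
  a22 = 2^-1 * m12 * omega ^+ 2 /\ b21 = 0 /\ mu1 = 0.
Proof.
move=> q a m12 motion m1_gt0 m2_gt0 /eqP om0 _ _ _ _ [eq_q eq_a] qae_free.
have m12_neq0 : m12 != 0 by rewrite gt_eqF // reduced_mass_gt0.
have [b21_0 mu1_0 kw0] :
    [/\ b21 = 0, mu1 = 0 & - (omega * k1 * w) = 0].
  by apply: (free3_eq0 qae_free); rewrite eq_a scaleNr subrr.
have horizontal : vec3 x y 0 = q - z *: e3.
  rewrite -scaleNr vec3Z vec3D.
  by congr vec3; ring.
have [a22E _ /eqP] :
    [/\ 2 * a22 - omega ^+ 2 * m12 = 0, b21 = 0 & omega ^+ 2 * m12 * z = 0].
  apply: (free3_eq0 qae_free).
  rewrite scalerBl [X in X + _]addrAC eq_q horizontal scalerBr scalerA.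
  by rewrite [X in X + _]addrAC subrr add0r addNr.
rewrite mulrI_eq0 => [/eqP z0|]; last first.
  by apply/mulfI; rewrite mulf_neq0 ?expf_neq0.
have q_neq0 : q != 0.
  by apply: (free_not0 qae_free); rewrite inE eqxx.
split=> //; split; last split; last split=> //.
- move=> /eqP k1_neq0.
  have w0 : w = 0.
    by move/eqP: kw0; rewrite oppr_eq0 !mulf_eq0 (negPf om0) (negPf k1_neq0)
      => /eqP.
  split=> // n d plane t.
  rewrite /motion /q z0 in plane; rewrite /q z0 in q_neq0.
  rewrite (horizontal_orbit_normal m1_gt0 m2_gt0 om0 q_neq0 plane).
  by rewrite /a w0 rot_e3_vec3 dot_vec3 !mul0r mulr0 !addr0.
- by rewrite /motion /q z0; exact: horizontal_lagrangian.
- move/eqP: a22E; rewrite subr_eq0 => /eqP a22E.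
  have two_neq0 : 2 != 0 :> R by rewrite pnatr_eq0.
  by rewrite -mulrA [m12 * _]mulrC -a22E mulKf.
Qed.
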